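(* Let $n\ge 1$, $N=2^n$, and let $f:\{0,\dots,N-1\}\to\{0,1\}$ have exactly $M$ matches (indices $i$ with $f(i)=1$), where $1\le M\le N$. After a single iteration ($q=1$) of the partial-diffusion search algorithm, the probability of outputting a match is $$P_s^{(1)}=5\left(\frac MN\right)-8\left(\frac MN\right)^2+4\left(\frac MN\right)^3 .$$ If $M/N>1/3$, then the prescribed number of iterations $\lfloor \pi/(2\theta)\rfloor$, where $\theta\in(0,\pi/2]$ and $\cos\theta=1-M/N$, equals $1$, and $P_s^{(1)}\ge 0.9$.
   Context: The partial-diffusion search algorithm acts on $n+1$ qubits with basis $|i\rangle\otimes|b\rangle$, $0\le i\le N-1$, $b\in\{0,1\}$ (the last qubit is the workspace). The oracle is the unitary $U_f(|i\rangle\otimes|b\rangle)=|i\rangle\otimes|b\oplus f(i)\rangle$. The partial diffusion operator is $D_p=(H^{\otimes n}\otimes I_1)(2|0\rangle\langle 0|-I_{n+1})(H^{\otimes n}\otimes I_1)$, where $H=\frac{1}{\sqrt2}\begin{pmatrix}1&1\\1&-1\end{pmatrix}$, $|0\rangle$ here is the all-zero basis state of the $n+1$ qubits, and $I_k$ is the $2^k\times 2^k$ identity. The algorithm with $q$ iterations: start from $|0\rangle^{\otimes n}\otimes|0\rangle$; apply $H$ to each of the first $n$ qubits, giving $\frac{1}{\sqrt N}\sum_{i=0}^{N-1}|i\rangle\otimes|0\rangle$; apply $D_pU_f$ ($U_f$ first, then $D_p$) $q$ times; measure the first $n$ qubits and output the result $i$. $P_s^{(q)}$ denotes the probability that the output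 satisfies $f(i)=1$. *)

(* Defs.v *)
From HB Require Import structures.
From mathcomp Require Import all_boot all_order all_algebra.
From mathcomp Require Import complex mxtens.
From mathcomp Require Import reals trigo.
Set Implicit Arguments.
Unset Strict Implicit.
Unset Printing Implicit Defensive.
Import Order.TTheory GRing.Theory Num.Theory.
Local Open Scope ring_scope.
Local Open Scope complex_scope.

Definition hadamard (R : realType) : 'M[R[i]]_2 :=
  ((Num.sqrt 2 : R)^-1)%:C *:
    \matrix_(j < 2, k < 2) (if (j == 1) && (k == 1) then -1 else 1).

Definition ket (R : realType) (d : nat) (i : 'I_d) : 'cV[R[i]]_d :=
  delta_mx i 0.

Definition zero_index (n : nat) : 'I_(2 ^ n) :=
  Ordinal (expn_gt0 2 n : (0 < 2 ^ n)%N).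

Definition bit (b : bool) : 'I_2 := inord b.

(* |i> (x) |b>, with i the value of the first n qubits and b the workspace
   qubit.  The space (C^2)^n (x) C^2 is C^(2 ^ n * 2), with index
   mxtens_index (i, bit b) for this vector; [tensmx] has 1 * 1 columns, which
   is convertible to 1. *)
Definition ket2 (R : realType) (n : nat) (i : 'I_(2 ^ n)) (b : bool) :
    'cV[R[i]]_(2 ^ n * 2) :=
  ket R i *t ket R (bit b).

(* |v><w| *)
Definition outer (R : realType) (d : nat) (v w : 'cV[R[i]]_d) : 'M[R[i]]_d :=
  v *m (map_mx (fun z => z^*) w)^T.

(* The linear operator sending each |i> (x) |b> to |i> (x) |b (+) f i>. *)
Definition oracle (R : realType) (n : nat) (f : 'I_(2 ^ n) -> bool) :
    'M[R[i]]_(2 ^ n * 2) :=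
  \sum_(i < 2 ^ n) \sum_(b : bool) outer (ket2 R i (b (+) f i)) (ket2 R i b).

(* Here [A ^t n] is the n-fold tensor power. *)
Definition hadamard_all (R : realType) (n : nat) : 'M[R[i]]_(2 ^ n * 2) :=
  (hadamard R ^t n) *t (1%:M : 'M[R[i]]_2).

Definition ket_zero (R : realType) (n : nat) : 'cV[R[i]]_(2 ^ n * 2) :=
  ket2 R (zero_index n) false.

Definition partial_diffusion (R : realType) (n : nat) :
    'M[R[i]]_(2 ^ n * 2) :=
  hadamard_all R n
    *m (2 *: outer (ket_zero R n) (ket_zero R n) - 1%:M)
    *m hadamard_all R n.

Definition final_state (R : realType) (n : nat) (f : 'I_(2 ^ n) -> bool)
    (q : nat) : 'cV[R[i]]_(2 ^ n * 2) :=
  iter q (mulmx (partial_diffusion R n *m oracle R f))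
    (hadamard_all R n *m ket_zero R n).

(* Born rule for the measurement of the first n qubits: the squared moduli of
   the amplitudes are summed over the unmeasured workspace qubit. *)
Definition output_prob (R : realType) (n : nat) (f : 'I_(2 ^ n) -> bool)
    (q : nat) (i : 'I_(2 ^ n)) : R :=
  \sum_(b : bool)
    ComplexField.Normc.normc
      (final_state R f q (mxtens_index (i, bit b)) 0) ^+ 2.

Definition success_prob (R : realType) (n : nat) (f : 'I_(2 ^ n) -> bool)
    (q : nat) : R :=
  \sum_(i < 2 ^ n | f i) output_prob R f q i.

Definition prescribed_iterations (R : realType) (theta : R) : int :=
  Num.floor (pi / (2 * theta)).

(* Main.v *)
(** The initial state psi has amplitude a = 2^(-n/2) on every |i>|0>.  Since
    H^(x)n is a symmetric involution, the partial diffusion is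
    the reflection 2 |psi><psi| - 1.  Writing r = M / N, the overlap of psi with
    U_f psi is 1 - r, so one iteration gives a match the amplitudes
    2 (1 - r) a on |0> and - a on |1>, hence success probability
    r (4 (1 - r)^2 + 1). *)
Require Import Defs.
From HB Require Import structures.
From mathcomp Require Import all_boot all_order all_algebra.
From mathcomp Require Import complex mxtens ring lra.
From mathcomp Require Import reals trigo.
Set Implicit Arguments.
Unset Strict Implicit.
Unset Printing Implicit Defensive.
Import Order.TTheory GRing.Theory Num.Theory.
Local Open Scope ring_scope.

Lemma bitK : cancel bit (fun j : 'I_2 => j == 1).
Proof. by case; rewrite -val_eqE /= inordK. Qed.

Lemma eq1_bitK : cancel (fun j : 'I_2 => j == 1) bit.
Proof.
by move=> j; apply: val_inj; case: j => [[|[|//]]] ? /=; rewrite inordK.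
Qed.

Lemma tensmx11 (R : pzRingType) m n :
  (1%:M : 'M[R]_m) *t (1%:M : 'M[R]_n) = 1%:M.
Proof.
apply/matrixP => i j; case: (mxtens_indexP i) => i1 i2.
case: (mxtens_indexP j) => j1 j2.
rewrite tensmxE !mxE (can_eq (@mxtens_indexK _ _)) xpair_eqE.
by case: eqP; case: eqP; rewrite /= ?mulr1 ?mulr0.
Qed.

Lemma ntensmxX2 (R : comPzRingType) m (A : 'M[R]_m) k :
  A *m A = 1%:M -> A ^t k *m A ^t k = 1%:M.
Proof.
move=> AA; case: k => [|k]; first exact: mulmx1.
(* For positive exponents the recursion of [ntensmx] bottoms out at [A], not at the identity, so
   power 0 is split off first and the induction starts at power 1. *)
rewrite /ntensmx; elim: k => [|k IH]; first exact: AA.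
by rewrite /= tensmx_mul AA IH tensmx11.
Qed.

Lemma trmx_ntens (R : comPzRingType) m (A : 'M[R]_m) k :
  (A ^t k)^T = A^T ^t k.
Proof.
case: k => [|k]; first exact: trmx1.
rewrite /ntensmx; elim: k => [//|k IH].
by rewrite /= trmx_tens IH.
Qed.

(** All binary digits of the column index are 0, so the entry is a product of [k] entries from
    column 0 of [A]. For the Hadamard matrix this gives the uniform superposition. *)
Lemma ntensmx_col0 (R : comPzRingType) (A : 'M[R]_2) (a : R) k i :
  (forall j, A j 0 = a) -> (A ^t k) i (zero_index k) = a ^+ k.
Proof.
move=> Aa; case: k i => [|k] i.
  have -> : i = zero_index 0 by apply: val_inj; case: i => [[|j]].
  by rewrite [A ^t 0]/(1%:M) mxE eqxx.
rewrite /ntensmx; elim: k i => [|k IH] i.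
  by rewrite expr1 -(Aa i); congr (A i _); apply: val_inj.
have -> : zero_index k.+2 =
    @mxtens_index 2 (2 ^ k.+1) (ord0, zero_index k.+1) by exact: val_inj.
rewrite exprS -(IH (mxtens_unindex i).2) -(Aa (mxtens_unindex i).1).
by rewrite -[in LHS](mxtens_unindexK i); exact: tensmxE.
Qed.

Section Algorithm.
Variables (R : realType) (n : nat).
Local Open Scope complex_scope.
Local Notation amp := ((Num.sqrt 2 : R)^-1 ^+ n).
Local Notation init := (hadamard_all R n *m ket_zero R n).

Lemma hadamardX2 : hadamard R *m hadamard R = 1%:M.
Proof.
rewrite -scalemxAl -scalemxAr scalerA -rmorphM -expr2 exprVn sqr_sqrtr //.
apply/matrixP => i j; rewrite !mxE !big_ord_recl big_ord0 !mxE.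
rewrite fmorphV rmorph_nat.
by case: i j => [[|[|//]] ?] [[|[|//]] ?] /=; field; rewrite ?pnatr_eq0.
Qed.

Lemma hadamard_tr : (hadamard R)^T = hadamard R.
Proof. by apply/matrixP => i j; rewrite !mxE andbC. Qed.

Lemma hadamard_allX2 : hadamard_all R n *m hadamard_all R n = 1%:M.
Proof.
rewrite tensmx_mul mulmx1 ntensmxX2 ?tensmx11 //; exact: hadamardX2.
Qed.

Lemma hadamard_all_tr : (hadamard_all R n)^T = hadamard_all R n.
Proof. by rewrite trmx_tens trmx1 trmx_ntens hadamard_tr. Qed.

Lemma ket2E i b :
  ket2 R i b = delta_mx (mxtens_index (i, bit b)) 0 :> 'cV_(2 ^ n * 2).
Proof.
apply/matrixP => k j; case: (mxtens_indexP k) => k1 k2.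
rewrite [j]ord1.
(* The tensor product of two columns has its column index in [1 * 1]; writing it as a pair lets
   [tensmxE] apply. *)
have -> : (0 : 'I_1) = @mxtens_index 1 1 (0, 0) by exact: val_inj.
rewrite [LHS]tensmxE !mxE (can_eq (@mxtens_indexK _ _)) xpair_eqE !eqxx !andbT.
by case: eqP; case: eqP; rewrite /= ?mulr1 ?mulr0.
Qed.

Lemma outer_delta d (x y : 'I_d) :
  outer (delta_mx x 0 : 'cV[R[i]]_d) (delta_mx y 0) = delta_mx x y.
Proof.
rewrite /outer.
have -> : map_mx (fun z => z^*) (delta_mx y 0 : 'cV[R[i]]_d) = delta_mx y 0.
  by apply/matrixP => i j; rewrite !mxE; exact: conjc_nat.
by rewrite trmx_delta mul_delta_mx.
Qed.

(** The oracle permutes the basis and is its own inverse, so each amplitude is read off at the image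
    of its index. *)
Lemma oracleE (f : 'I_(2 ^ n) -> bool) (v : 'cV[R[i]]_(2 ^ n * 2)) i b :
  (oracle R f *m v) (mxtens_index (i, bit b)) 0 =
  v (mxtens_index (i, bit (b (+) f i))) 0.
Proof.
rewrite /oracle mulmx_suml summxE (bigD1 i) //=.
rewrite [X in _ + X]big1 ?addr0; last first.
  move=> j ji; rewrite mulmx_suml summxE big1 // => c _.
  rewrite !ket2E outer_delta !mxE big1 // => k _.
  rewrite mxE (can_eq (@mxtens_indexK _ _)) xpair_eqE.
  by rewrite eq_sym (negPf ji) /= mul0r.
rewrite mulmx_suml summxE (bigD1 (b (+) f i)) //=.
rewrite [X in _ + X]big1 ?addr0; last first.
  move=> c cb; rewrite !ket2E outer_delta !mxE big1 // => k _.
  rewrite mxE (can_eq (@mxtens_indexK _ _)) xpair_eqE eqxx /= (can_eq bitK).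
  by case: b c (f i) cb => [] [] [] //= _; rewrite mul0r.
rewrite addbK !ket2E outer_delta mxE.
rewrite (bigD1 (mxtens_index (i, bit (b (+) f i)))) //=.
rewrite mxE !eqxx mul1r big1 ?addr0 // => k /negPf nk.
by rewrite mxE nk andbF mul0r.
Qed.

Lemma initE i b :
  init (mxtens_index (i, bit b)) 0 = (if b then 0 else amp)%:C.
Proof.
rewrite /ket_zero ket2E -colE mxE tensmxE mxE (can_eq bitK).
rewrite (ntensmx_col0 (a := ((Num.sqrt 2 : R)^-1)%:C)) => [|j].
  by case: b; rewrite /= ?mulr0 ?mulr1 ?rmorphXn.
by rewrite !mxE andbF mulr1.
Qed.

(* [init] has real entries, so the adjoint in |init><init| is a transpose. *)
Lemma partial_diffusionE (v : 'cV[R[i]]_(2 ^ n * 2)) :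
  partial_diffusion R n *m v = (2 * (init^T *m v) 0 0) *: init - v.
Proof.
rewrite /partial_diffusion mulmxBr mulmxBl mulmx1 hadamard_allX2 mulmxBl mul1mx.
congr (_ - _); rewrite -scalemxAr -!scalemxAl -scalerA; congr (_ *: _).
have -> : outer (ket_zero R n) (ket_zero R n) =
    ket_zero R n *m (ket_zero R n)^T.
  by rewrite /ket_zero ket2E outer_delta trmx_delta mul_delta_mx.
rewrite -mul_mx_scalar -mx11_scalar trmx_mul hadamard_all_tr.
by rewrite !mulmxA.
Qed.

Lemma amp2 : amp ^+ 2 = (2 ^ n)%:R^-1.
Proof.
by rewrite -exprM mulnC exprM exprVn sqr_sqrtr // natrX exprVn.
Qed.

Lemma big_mxtens_bit (F : 'I_(2 ^ n * 2) -> R[i]) :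
  \sum_k F k = \sum_(i < 2 ^ n) \sum_(b : bool) F (mxtens_index (i, bit b)).
Proof.
rewrite pair_big /= (reindex (fun p : 'I_(2 ^ n) * bool =>
   mxtens_index (p.1, bit p.2))) //=.
exists (fun k => ((mxtens_unindex k).1, (mxtens_unindex k).2 == 1)).
  by move=> [i b] _; rewrite mxtens_indexK bitK.
by move=> k _; rewrite /= eq1_bitK; exact: mxtens_unindexK.
Qed.

Lemma overlap_oracle (f : 'I_(2 ^ n) -> bool) :
  (init^T *m (oracle R f *m init)) 0 0 =
  (1 - #|[set i | f i]|%:R / (2 ^ n)%:R)%:C.
Proof.
rewrite mxE big_mxtens_bit.
transitivity (\sum_(i < 2 ^ n)
    (if i \in ~: [set i | f i] then (2 ^ n)%:R^-1 else 0 : R)%:C).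
  apply: eq_bigr => i _; rewrite big_bool ![_^T 0 _]mxE !oracleE !initE !inE.
  rewrite -amp2 -!rmorphM /= -(rmorphD (real_complex R)); congr (_%:C).
  by case: (f i) => /=; rewrite !(mul0r, mulr0, add0r) // expr2.
rewrite -rmorph_sum; congr (_%:C); rewrite -big_mkcond /=.
rewrite sumr_const cardsCs setCK card_ord.
rewrite -[LHS]mulr_natl natrB ?mulrBl ?divff //;
  first by rewrite pnatr_eq0 -lt0n expn_gt0.
by rewrite -[X in (_ <= X)%N]card_ord max_card.
Qed.

Lemma final_state1E (f : 'I_(2 ^ n) -> bool) i b :
  let ratio : R := #|[set i | f i]|%:R / (2 ^ n)%:R in
  final_state R f 1 (mxtens_index (i, bit b)) 0 =
  ((if b then 0 else 2 * (1 - ratio) * amp) -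
    (if b (+) f i then 0 else amp))%:C.
Proof.
move=> ratio; rewrite /final_state /= -mulmxA partial_diffusionE.
rewrite overlap_oracle 2!mxE [in X in _ + X]mxE oracleE !initE.
rewrite [RHS](rmorphB (real_complex R)) -/ratio; congr (_ - _).
case: b; first by rewrite mulr0.
by rewrite !(rmorphM (real_complex R)) (rmorph_nat (real_complex R)).
Qed.

Lemma success_prob1E (f : 'I_(2 ^ n) -> bool) :
  let ratio : R := #|[set i | f i]|%:R / (2 ^ n)%:R in
  success_prob R f 1 = ratio * (4 * (1 - ratio) ^+ 2 + 1).
Proof.
move=> ratio; rewrite /success_prob.
(* All matches are equally likely outputs, so the sum is this common probability times their
   number. *)
rewrite (eq_bigr (fun=> (2 ^ n)%:R^-1 * (4 * (1 - ratio) ^+ 2 + 1))) => [|i fi].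
  by rewrite -big_set sumr_const -[LHS]mulr_natl mulrA.
have normR (x : R) : ComplexField.Normc.normc x%:C ^+ 2 = x ^+ 2.
  by rewrite /= expr0n addr0 sqr_sqrtr ?sqr_ge0.
rewrite /output_prob big_bool !final_state1E -/ratio !normR fi /= -amp2; ring.
Qed.

End Algorithm.

(* The cubic exceeds 25/27 by 4 (x - 1/3) (x - 5/6)^2. *)
Lemma success_cubic_ge (R : realFieldType) (x : R) :
  1 / 3 < x -> 9 / 10 <= 5 * x - 8 * x ^+ 2 + 4 * x ^+ 3.
Proof.
move=> x3; have : 0 <= (x - 1 / 3) * (x - 5 / 6) ^+ 2.
  by rewrite mulr_ge0 ?sqr_ge0 // subr_ge0 ltW.
have -> : (x - 1 / 3) * (x - 5 / 6) ^+ 2 =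
  (5 * x - 8 * x ^+ 2 + 4 * x ^+ 3 - 25 / 27) / 4 by field.
lra.
Qed.

(* If theta <= pi / 4 then 2 (cos theta)^2 - 1 = cos (2 theta) >= 0, against
   2 (2 / 3)^2 < 1. *)
Lemma prescribed_iterations_eq1 (R : realType) (theta : R) :
  0 < theta <= pi / 2 -> 0 <= cos theta < 2 / 3 ->
  prescribed_iterations theta = 1.
Proof.
move=> /andP[t0 tpi] /andP[c0 c23].
have pi4 : pi < 4 * theta.
  rewrite ltNge; apply/negP => le_pi.
  have : 0 <= cos (theta *+ 2).
    by apply: cos_ge0_pihalf; rewrite -mulr_natl; lra.
  rewrite cos_mulr2n -mulr_natl.
  have : cos theta ^+ 2 < (2 / 3) ^+ 2 by rewrite ltrXn2r // ?nnegrE; lra.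
  lra.
(* The floor is 1 because [2 * theta <= pi < 4 * theta]. *)
apply: floor_def; rewrite ler_pdivlMr ?ltr_pdivrMr; lra.
Qed.

Theorem mainTheorem2 (R : realType) (n : nat) (f : 'I_(2 ^ n) -> bool)
    (M : nat) (n_ge1 : (1 <= n)%N)
    (matches : #|[set i : 'I_(2 ^ n) | f i]| = M)
    (M_bounds : (1 <= M <= 2 ^ n)%N) :
  let ratio : R := M%:R / (2 ^ n)%:R in
  success_prob R f 1 = 5 * ratio - 8 * ratio ^+ 2 + 4 * ratio ^+ 3 /\
  (1 / 3 < ratio ->
     (forall theta : R, 0 < theta <= pi / 2 -> cos theta = 1 - ratio ->
        prescribed_iterations theta = 1) /\
     9 / 10 <= success_prob R f 1).
Proof.
move=> ratio.
have probE : success_prob R f 1 = 5 * ratio - 8 * ratio ^+ 2 + 4 * ratio ^+ 3.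
  by rewrite success_prob1E matches -/ratio; ring.
split=> // ratio_gt; rewrite probE; split; last exact: success_cubic_ge.
move=> theta theta_itv cosE; apply: prescribed_iterations_eq1 => //.
(* This bound gives [0 <= cos theta], while [ratio_gt] gives [cos theta < 2 / 3]. *)
have ratio_le1 : ratio <= 1.
  case/andP: M_bounds => _ le_MN.
  by rewrite ler_pdivrMr ?mul1r ?ler_nat // ltr0n expn_gt0.
rewrite cosE; lra.
Qed.
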